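(* Let $k\in\mathbb Z$ and let $n$ be an integer with $1\le n\le N-1$. The expected numbers of arrivals $x_{kN+n}$ at the states between the barriers, for the walk started in $i_0$, satisfy the following. Case $\rho\neq1$: $$(1-\rho^N)x_{kN+n}=\begin{cases}\dfrac{p_0}{p}[\rho^{n}-\rho^N]x_{kN}+\dfrac{q_0}{q}[1-\rho^{n}]x_{(k+1)N}+\dfrac{(1-\rho^n)(\rho^{N-i_0}-1)}{p-q}\,\delta(k,0) & (1\le n\le i_0),\\[2ex] \dfrac{p_0}{p}[\rho^{n}-\rho^N]x_{kN}+\dfrac{q_0}{q}[1-\rho^{n}]x_{(k+1)N}+\dfrac{(\rho^n-\rho^N)(1-\rho^{-i_0})}{p-q}\,\delta(k,0) & (i_0\le n\le N-1).\end{cases}$$ Case $\rho=1$: $$x_{kN+n}=\begin{cases}\dfrac{p_0(N-n)x_{kN}+q_0n\,x_{(k+1)N}+n(N-i_0)\,\delta(k,0)}{pN} & (1\le n\le i_0),\\[2ex] \dfrac{p_0(N-n)x_{kN}+q_0n\,x_{(k+1)N}+i_0(N-n)\,\delta(k,0)}{pN} & (i_0\le n\le N-1).\end{cases}$$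
   Context: Setting. Let $N>1$ be an integer. Consider a discrete-time random walk on $\mathbb Z$ with a multiple function barrier (MFB) at every point $kN$, $k\in\mathbb Z$. At each time step, a walker located at an MFB $kN$ moves to $kN+1$ with probability $p_0$, moves to $kN-1$ with probability $q_0$, stays in $kN$ with probability $r_0$, and is absorbed in that MFB (the walk ends) with probability $s_0$, where $p_0+q_0+r_0+s_0=1$, $r_0\ge 0$ and $p_0q_0s_0>0$. A walker located at a point that is not a multiple of $N$ moves one step forward ($+1$) with probability $p$, one step backward ($-1$) with probability $q$, and stays with probability $r=1-p-q\ge 0$, where $pq>0$. The walk starts in $i_0$, an integer with $0\le i_0<N$. Notation. $x_j=\sum_{m=0}^{\infty}p_{i_0j}^{(m)}$ is the expected number of arrivals in state $j$, where $p_{ij}^{(m)}$ is the probability that the walker started in $i$ is at $j$ after $m$ steps, not yet absorbed (time $0$ is counted). $\rho=p/q$. $\delta(\cdot,\cdot)$ is the Kronecker delta. *)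

(* Defs.v *)
From HB Require Import structures.
From mathcomp Require Import all_boot all_order all_algebra.
From mathcomp Require Import all_classical all_reals all_analysis.

Set Implicit Arguments.
Unset Strict Implicit.
Unset Printing Implicit Defensive.

Import Order.TTheory GRing.Theory Num.Theory.

Local Open Scope classical_set_scope.
Local Open Scope ring_scope.

(* The Markov property is written multiplicatively, so that histories of       *)
(* probability 0 need no special treatment: it says that, conditionally on     *)
(* X 0 = a 0, ..., X m = a m, the next state is a m.+1 with probability        *)
(* Q (a m) (a m.+1).                                                           *)
Record markov_chain (d : measure_display) (T : measurableType d) (R : realType)
    (P : probability T R) (S : countType) (x0 : S) (Q : S -> S -> R)
    (X : nat -> T -> S) : Prop := MarkovChain {
  mc_measurable : forall (m : nat) (y : S), measurable [set w | X m w = y];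
  mc_init : P [set w | X 0%N w = x0] = 1%E;
  mc_step : forall (m : nat) (a : nat -> S),
    P [set w | forall l : nat, (l <= m.+1)%N -> X l w = a l] =
    (P [set w | forall l : nat, (l <= m)%N -> X l w = a l]
     * (Q (a m) (a m.+1))%:E)%E }.

(* [Some i] is the walker at the integer i, [None] the absorbed walker.        *)
Definition mfb_transition (R : realType) (N : nat) (p0 q0 r0 s0 p q r : R)
    (u v : option int) : R :=
  match u, v with
  | Some i, Some j =>
      if (N %| i)%Z
      then p0 *+ (j == i + 1) + q0 *+ (j == i - 1) + r0 *+ (j == i)
      else p *+ (j == i + 1) + q *+ (j == i - 1) + r *+ (j == i)
  | Some i, None => if (N %| i)%Z then s0 else 0
  | None, Some _ => 0
  | None, None => 1
  end.

Definition expected_arrivals (d : measure_display) (T : measurableType d)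
    (R : realType) (P : probability T R) (X : nat -> T -> option int)
    (j : int) : \bar R :=
  (\sum_(0 <= m <oo) P [set w | X m w = Some j])%E.

(* Main.v *)
(* The occupation probabilities P(X_m = j) obey the one-step recursion of the
   transition matrix Q. Since Q is tridiagonal on the integers, this forward
   recursion agrees with the backward one, to which a supersolution applies: if
   V >= 0 satisfies 1 + QV <= V, then the expected number of visits to any state
   is at most V(i_0); such a V exists because the walk is killed at rate s_0 at
   the barriers. Summing the recursion over m gives x = delta + xQ. Between two
   barriers this is a second-order linear recurrence whose increments form,
   away from the source i_0, a geometric progression of ratio rho; solving it
   with the two boundary values gives a formula in the sums
   1 + rho + ... + rho^(n-1), which covers both cases. *)

Require Import Defs.
From HB Require Import structures.
From mathcomp Require Import all_boot all_order all_algebra.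
From mathcomp Require Import all_classical all_reals all_analysis.
From mathcomp Require Import zify ring lra.

Set Implicit Arguments.
Unset Strict Implicit.
Unset Printing Implicit Defensive.

Import Order.TTheory GRing.Theory Num.Theory.

Local Open Scope classical_set_scope.
Local Open Scope ring_scope.

(** * Events split along a countably valued variable *)

Lemma measurable_countType_preimage (d : measure_display)
    (T : measurableType d) (S : countType) (Y : T -> S) :
  (forall y, measurable [set w | Y w = y]) ->
  forall D : set S, measurable [set w | D (Y w)].
Proof.
move=> mY D.
have -> : [set w | D (Y w)] =
    \bigcup_(y : S) ([set w | Y w = y] `&` [set w : T | D y]).
  apply/seteqP; split=> w /=; first by move=> Dw; exists (Y w).
  by case=> y _ [/= ->].
apply: countable_bigcupT_measurable => // y; apply: measurableI => //.
have [Dy|nDy] := pselect (D y).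
  by rewrite (_ : [set _ | _] = setT); [exact: measurableT|apply/seteqP; split].
by rewrite (_ : [set _ | _] = set0); [exact: measurable0|apply/seteqP; split].
Qed.

(** Countable additivity over the fibres of [Y], indexed by [pickle]. It serves to forget one
    coordinate of a history and, with [c = 0], to discard unreachable predecessors. *)
Lemma measure_fiberwise_scale (d : measure_display) (T : measurableType d)
    (R : realType) (P : probability T R) (S : countType)
    (Y : T -> S) (A B : set T) (c : R) :
  (forall y, measurable [set w | Y w = y]) -> measurable A -> measurable B ->
  (forall y, P (A `&` [set w | Y w = y])
             = (c%:E * P (B `&` [set w | Y w = y]))%E) ->
  P A = (c%:E * P B)%E.
Proof.
move=> mY mA mB AB.
pose F (C : set T) k := C `&` [set w | pickle (Y w) = k].
have mF C k : measurable C -> measurable (F C k).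
  move=> mC; apply: measurableI => //.
  exact: (measurable_countType_preimage mY [set y | pickle y = k]).
have PF C : measurable C -> P C = (\sum_(0 <= k <oo) P (F C k))%E.
  move=> mC; have {1}-> : C = \bigcup_k F C k.
    by apply/seteqP; split=> w; [move=> Cw; exists (pickle (Y w))|case=> k _ []].
  apply: measure_semi_bigcup => [k||]; first exact: mF.
    by move=> k l _ _ [w [[_ /= <-] [_ /= <-]]].
  by apply: bigcupT_measurable => k; exact: mF.
rewrite (PF A)// (PF B)// -nneseriesZl//; apply: eq_eseriesr => k _.
case: (pselect (exists y : S, pickle y = k)) => [[y yk]|nk].
  have FE C : F C k = C `&` [set w | Y w = y].
    congr (_ `&` _); apply/seteqP; split=> w /=; rewrite -yk; last by move->.
    exact: (pcan_inj (@pickleK S)).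
  by rewrite !FE AB.
have F0 C : F C k = set0.
  by apply/seteqP; split=> w // [_ /= h]; case: nk; exists (Y w).
by rewrite !F0 !measure0 mule0.
Qed.

Lemma measure_split_seq (d : measure_display) (T : measurableType d)
    (R : realType) (P : probability T R) (S : countType)
    (Y : T -> S) (A : set T) (s : seq S) :
  (forall y, measurable [set w | Y w = y]) -> measurable A -> uniq s ->
  P A = (\sum_(y <- s) P (A `&` [set w | Y w = y])
          + P (A `&` [set w | Y w \notin s]))%E.
Proof.
move=> mY mA; elim: s => [_|y s ih /= /andP[ys us]].
  rewrite big_nil add0e; congr (P _).
  by apply/seteqP; split=> w //= [].
rewrite big_cons ih//= -addeA addeCA; congr (_ + _)%E.
rewrite -measureU//.
- congr (P _); apply/seteqP; split=> w /=.
    move=> [Aw ws]; have [wy|/eqP wy] := eqVneq (Y w) y; [by left|right].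
    by split=> //; rewrite in_cons negb_or ws andbT; apply/eqP.
  by case=> -[Aw]; [move=> ->|rewrite in_cons negb_or => /andP[]].
- by apply: measurableI.
- apply: measurableI => //.
  exact: (measurable_countType_preimage mY [set z | z \notin y :: s]).
- by apply/seteqP; split=> w //= [[_ ->]] [_]; rewrite in_cons eqxx.
Qed.

(** * From path laws to the forward recursion *)

Section markov.
Variables (d : measure_display) (T : measurableType d) (R : realType).
Variables (P : probability T R) (S : countType) (x0 : S) (Q : S -> S -> R).
Variable X : nat -> T -> S.
Hypothesis hX : markov_chain P x0 Q X.

Definition path_event (l m : nat) (a : nat -> S) : set T :=
  [set w | forall k, (l <= k <= m)%N -> X k w = a k].

Lemma measurable_path_event l m a : measurable (path_event l m a).
Proof.
rewrite (_ : path_event l m a =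
    \bigcap_(k in [set k | (l <= k <= m)%N]) [set w | X k w = a k]); last first.
  by apply/seteqP; split.
by apply: bigcap_measurableType => k _; exact: (mc_measurable hX).
Qed.

(** The hypothesis on the chain concerns full histories, which is the case [l = 0]. Induction on [l]
    forgets one more initial coordinate by summing over its value. *)
Lemma markov_path l m a : (l <= m)%N ->
  P (path_event l m.+1 a) = ((Q (a m) (a m.+1))%:E * P (path_event l m a))%E.
Proof.
elim: l a => [|l ih] a lm.
  have E k : path_event 0 k a = [set w | forall l, (l <= k)%N -> X l w = a l].
    by apply/seteqP; split.
  by rewrite !E (mc_step hX) muleC.
apply: (measure_fiberwise_scale (mc_measurable hX l));
  try exact: measurable_path_event.
(* Fixing X_l = y restores a window that starts at [l], and since l < m the transition from [a m] to
   [a m.+1] is unchanged. *)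
move=> y; pose b k := if k == l then y else a k.
have E k : path_event l.+1 k a `&` [set w | X l w = y] = path_event l k b
    \/ (k < l)%N.
  case: (leqP l k) => lk; [left|by right].
  apply/seteqP; split=> w /=.
    move=> [aw wy] j /andP[lj jk]; rewrite /b; case: eqVneq => [->//|jl].
    by apply: aw; rewrite jk ltn_neqAle eq_sym jl lj.
  move=> bw; split; last by rewrite (bw l) /b ?eqxx ?leqnn.
  move=> j /andP[lj jk]; rewrite (bw j) /b ?gtn_eqF//.
  by rewrite jk ltnW.
have [->|] := E m.+1; last by rewrite ltnNge leqW// ltnW.
have [->|] := E m; last by rewrite ltnNge ltnW.
have bE k : (l < k)%N -> a k = b k by move=> lk; rewrite /b gtn_eqF.
by rewrite (bE m)// (bE m.+1) ?leqW//; exact: ih (ltnW lm).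
Qed.

Lemma markov_joint m x y :
  P ([set w | X m.+1 w = y] `&` [set w | X m w = x])
  = ((Q x y)%:E * P [set w | X m w = x])%E.
Proof.
pose a k := if k == m then x else y.
have am : a m = x by rewrite /a eqxx.
have am1 : a m.+1 = y by rewrite /a gtn_eqF.
have := markov_path a (leqnn m); rewrite am am1.
rewrite (_ : path_event m m.+1 a =
    [set w | X m.+1 w = y] `&` [set w | X m w = x]); last first.
  apply/seteqP; split=> w /=.
    by move=> aw; rewrite -am -am1 !aw ?leqnn ?leqnSn.
  move=> [wy wx] k /andP[mk]; rewrite leq_eqVlt ltnS => /orP[/eqP->|km].
    by rewrite am1.
  by rewrite (_ : k = m) ?wx ?am//; apply/eqP; rewrite eqn_leq km mk.
rewrite (_ : path_event m m a = [set w | X m w = x])//.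
apply/seteqP; split=> w /=; first by rewrite -am; apply; rewrite leqnn.
by move=> wx k; rewrite -eqn_leq => /eqP <-; rewrite wx am.
Qed.

(** A finite list containing all predecessors of [y] suffices: the other states contribute null
    events, so no series over [S] appears. *)
Lemma markov_forward m y (s : seq S) : uniq s ->
  (forall x, x \notin s -> Q x y = 0) ->
  P [set w | X m.+1 w = y]
  = (\sum_(x <- s) (Q x y)%:E * P [set w | X m w = x])%E.
Proof.
move=> us Qs; have mX := mc_measurable hX.
rewrite (measure_split_seq _ (mX m) (mX m.+1 y) us).
under eq_bigr do rewrite markov_joint.
rewrite [X in (_ + X)%E](_ : _ = 0%E) ?adde0//.
have mN : measurable ([set w | X m.+1 w = y] `&` [set w | X m w \notin s]).
  apply: measurableI => //.
  exact: (measurable_countType_preimage (mX m) [set z | z \notin s]).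
have := @measure_fiberwise_scale _ _ _ P _ (X m) _ _ 0 (mX m) mN
  (@measurableT _ T).
rewrite mul0e; apply=> x; rewrite mul0e.
case: (boolP (x \in s)) => xs.
  rewrite (_ : _ `&` _ = set0) ?measure0//.
  by apply/seteqP; split=> w //= [[_ ws] wx]; move: ws; rewrite wx xs.
apply/eqP; rewrite eq_le measure_ge0 andbT.
have <- : P ([set w | X m.+1 w = y] `&` [set w | X m w = x]) = 0%E.
  by rewrite markov_joint Qs// mul0e.
apply: le_measure; rewrite ?inE//; try exact: measurableI.
by move=> w [[wy _] wx]; split.
Qed.

Lemma markov_start y : P [set w | X 0%N w = y] = ((y == x0)%:R)%:E.
Proof.
have mX := mc_measurable hX 0%N; have [->|ny] := eqVneq y x0.
  exact: mc_init hX.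
have : (P [set w | X 0%N w = x0] + P [set w | X 0%N w = y] <= 1)%E.
  rewrite -measureU//; first exact: probability_le1 (measurableU _ _ _ _).
  by apply/seteqP; split=> w //= [->] /eqP; rewrite eq_sym (negbTE ny).
rewrite (mc_init hX) -[leRHS]adde0 leeD2lE// => h.
by apply/eqP; rewrite eq_le h measure_ge0.
Qed.

End markov.

(** * Positions relative to the barriers *)

Lemma dvdz_MDl (N n : nat) (k : int) : (N %| k * N%:Z + n%:Z)%Z = (N %| n)%N.
Proof. by rewrite rpredDl ?dvdz_mull. Qed.

Lemma dvdz_between (N n : nat) (k : int) : (0 < n < N)%N ->
  (N %| k * N%:Z + n%:Z)%Z = false.
Proof. by move=> /andP[n0 nN]; rewrite dvdz_MDl gtnNdvd. Qed.

Lemma divz_decomp (N : nat) (i : int) : (0 < N)%N ->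
  exists k : int, exists2 n : nat, (n < N)%N & i = k * N%:Z + n%:Z.
Proof.
move=> N0; have N0' : N%:Z != 0 by case: N N0.
exists (i %/ N)%Z, `|(i %% N)%Z|%N; last by rewrite gez0_abs ?modz_ge0// -divz_eq.
by rewrite -ltz_nat gez0_abs ?modz_ge0// ltz_pmod.
Qed.

Lemma divz_decomp_uniq (N m i : nat) (k : int) : (m < N)%N -> (i < N)%N ->
  k * N%:Z + m%:Z = i%:Z -> k = 0.
Proof.
move=> mN iN /(congr1 (fun z => z %/ N)%Z).
have N0 : N%:Z != 0 by case: N mN {iN}.
by rewrite divzMDl// !divz_nat !divn_small// addr0.
Qed.

(** * Powers of a tridiagonal kernel *)

Section tridiagonal_kernel.
Variables (R : realType) (up down stay : int -> R).

(* First-step form of the entry (i, j) of the m-th power of the kernel. *)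
Fixpoint tri_iter (m : nat) (i j : int) : R :=
  if m is m'.+1 then up i * tri_iter m' (i + 1) j
    + down i * tri_iter m' (i - 1) j + stay i * tri_iter m' i j
  else (j == i)%:R.

(** This is the identity Q Q^m = Q^m Q: the recursive definition conditions on the first step,
    whereas occupation probabilities evolve by the last one. *)
Lemma tri_iter_last m i j :
  tri_iter m.+1 i j = up (j - 1) * tri_iter m i (j - 1)
    + down (j + 1) * tri_iter m i (j + 1) + stay j * tri_iter m i j.
Proof.
elim: m i j => [|m ih] i j; last first.
  have E i' j' : tri_iter m.+1 i' j' = up i' * tri_iter m (i' + 1) j'
      + down i' * tri_iter m (i' - 1) j' + stay i' * tri_iter m i' j' by [].
  rewrite (_ : tri_iter m.+2 i j = up i * tri_iter m.+1 (i + 1) j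
    + down i * tri_iter m.+1 (i - 1) j + stay i * tri_iter m.+1 i j)//.
  by rewrite [in LHS]ih [in LHS]ih [in LHS]ih !E; ring.
rewrite /= subr_eq (eq_sym (j + 1)) -(subr_eq i) (eq_sym (i - 1)).
congr (_ + _ + _).
- by case: eqP => [->|_]; rewrite ?addrK ?mulr0.
- by case: eqP => [->|_]; rewrite ?subrK ?mulr0.
- by case: eqP => [->|_]; rewrite ?mulr0.
Qed.

Hypothesis up_ge0 : forall i, 0 <= up i.
Hypothesis down_ge0 : forall i, 0 <= down i.
Hypothesis stay_ge0 : forall i, 0 <= stay i.

(** Induction on [M]: the term m = 0 is at most 1, and the rest is Q applied to a shorter sum, hence
    at most QV. *)
Lemma tri_iter_sum_le (V : int -> R) : (forall i, 0 <= V i) ->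
  (forall i, 1 + up i * V (i + 1) + down i * V (i - 1) + stay i * V i <= V i) ->
  forall M i j, \sum_(0 <= m < M) tri_iter m i j <= V i.
Proof.
move=> V0 hV; elim=> [|M ih] i j; first by rewrite big_geq.
apply: le_trans (hV i); rewrite big_nat_recl//= !big_split/= -!mulr_sumr !addrA.
by rewrite !lerD ?ler_wpM2l//; case: eqP.
Qed.

End tridiagonal_kernel.

(** * A supersolution for the walk with barriers *)

Section mfb_kernel.
Variables (R : realType) (N : nat) (p0 q0 r0 s0 p q r : R).
Hypotheses (hN : (1 < N)%N) (hp0 : 0 <= p0) (hq0 : 0 <= q0) (hr0 : 0 <= r0).
Hypotheses (hs0 : 0 < s0) (hsum0 : p0 + q0 + r0 + s0 = 1).
Hypotheses (hp : 0 < p) (hq : 0 < q) (hr : 0 <= r) (hrE : r = 1 - p - q).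

Definition mfb_up (i : int) := if (N %| i)%Z then p0 else p.
Definition mfb_down (i : int) := if (N %| i)%Z then q0 else q.
Definition mfb_stay (i : int) := if (N %| i)%Z then r0 else r.

(* A bounded supersolution V >= 1 + QV, so V bounds the expected lifetime.
   Between barriers A^N - A^n loses at least 1 per step on average, and dropping
   it to 0 at both ends only helps; the killing rate s0 then fixes B. *)
Let A : R := 1 + (q + 1) / p.
Let B : R := (1 + A ^+ N) / s0.
Let V (i : int) : R :=
  B + (if (N %| i)%Z then 0 else A ^+ N - A ^+ `|(i %% N)%Z|%N).

Let A_ge1 : 1 <= A. Proof. by rewrite /A lerDl divr_ge0// ?addr_ge0 ?ltW. Qed.

Let A_ge0 : 0 <= A. Proof. exact: le_trans A_ge1. Qed.

Let B_ge0 : 0 <= B.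
Proof. by rewrite divr_ge0 ?addr_ge0 ?exprn_ge0// ltW. Qed.

Let V_between k n : (0 < n < N)%N ->
  V (k * N%:Z + n%:Z) = B + (A ^+ N - A ^+ n).
Proof.
move=> n0N; rewrite /V dvdz_between// modzMDl.
by case/andP: n0N => n0 nN; rewrite modz_small//= ltz_nat nN.
Qed.

(** Including both ends lets the neighbours of an interior point be bounded without asking whether
    they are barriers. *)
Let V_le_profile k n : (n <= N)%N ->
  V (k * N%:Z + n%:Z) <= B + (A ^+ N - A ^+ n).
Proof.
move=> nN; case: (boolP (0 < n < N)%N) => [/V_between->//|h].
rewrite /V ifT ?lerD2l ?subr_ge0 ?ler_weXn2l//.
rewrite dvdz_MDl; have [->//|nN'] := eqVneq n N.
by move: h; rewrite negb_and -leqNgt leqn0 -leqNgt (leqNgt N) ltn_neqAle nN' nN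
  orbF => /eqP->.
Qed.

Let V_ge i : B <= V i.
Proof.
have [k [n nN ->]] := divz_decomp i (ltnW hN).
have [->|n0] := posnP n.
  by rewrite /V dvdz_MDl dvdn0 addr0.
by rewrite V_between ?n0// lerDl subr_ge0 ler_weXn2l// ltnW.
Qed.

Let V_le i : V i <= B + A ^+ N.
Proof.
by rewrite /V lerD2l; case: ifP => _; rewrite ?exprn_ge0// gerDl oppr_le0 exprn_ge0.
Qed.

Let V_super i :
  1 + mfb_up i * V (i + 1) + mfb_down i * V (i - 1) + mfb_stay i * V i <= V i.
Proof.
move: (hr0) (hs0) (hsum0) (hp) (hq) (hr) (hrE) => ? ? ? ? ? ? ?.
rewrite /mfb_up /mfb_down /mfb_stay; case: ifPn => hi.
  have Vi : V i = B by rewrite /V hi addr0.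
  (* The loss s_0 B by absorption pays for the time step and for the gain of at most (p_0 + q_0) A^N
     on leaving the barrier. *)
  have sB : s0 * B = 1 + A ^+ N by rewrite mulrC divfK ?gt_eqF.
  have h1 := ler_wpM2l hp0 (V_le (i + 1)).
  have h2 := ler_wpM2l hq0 (V_le (i - 1)).
  have AN : 0 <= A ^+ N by rewrite exprn_ge0.
  have : (p0 + q0) * A ^+ N <= 1 * A ^+ N by rewrite ler_wpM2r//; lra.
  rewrite Vi; have -> : r0 = 1 - p0 - q0 - s0 by lra.
  nra.
have [k [n nN ik]] := divz_decomp i (ltnW hN).
have n0 : (0 < n)%N by apply: contraR hi; rewrite -eqn0Ngt ik dvdz_MDl => /eqP->.
rewrite {}ik {hi}.
have h1 : V (k * N%:Z + n%:Z + 1) <= B + (A ^+ N - A ^+ n.+1).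
  by rewrite -addrA -PoszD addn1; exact: V_le_profile.
have h2 : V (k * N%:Z + n%:Z - 1) <= B + (A ^+ N - A ^+ n.-1).
  rewrite -addrA -{1}(prednK n0) -addn1 PoszD addrK.
  by rewrite V_le_profile// -ltnS prednK// ltnW// ltnS ltnW.
have {}h1 := ler_wpM2l (ltW hp) h1; have {}h2 := ler_wpM2l (ltW hq) h2.
rewrite V_between ?n0// hrE.
suff : 1 <= p * (A ^+ n.+1 - A ^+ n) + q * (A ^+ n.-1 - A ^+ n) by lra.
rewrite -(prednK n0) !exprS /=; set t := A ^+ _.
have t1 : 1 <= t by rewrite exprn_ege1.
(* All three factors are at least 1: A - 1 = (q + 1)/p with p <= 1, and pA - q = p + 1. *)
have -> : p * (A * (A * t) - A * t) + q * (t - A * t) = t * ((A - 1) * (p * A - q)).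
  by ring.
have pA : p * A = p + q + 1 by rewrite /A; field; rewrite gt_eqF.
rewrite mulr_ege1// mulr_ege1//; last by rewrite pA; lra.
by rewrite /A addrC addKr ler_pdivlMr//; lra.
Qed.

Lemma mfb_iter_sum_bounded i : exists C, forall M j,
  \sum_(0 <= m < M) tri_iter mfb_up mfb_down mfb_stay m i j <= C.
Proof.
exists (V i) => M j; apply: tri_iter_sum_le V_super _ _ _ => {}i.
- by rewrite /mfb_up; case: ifP => // _; exact: ltW.
- by rewrite /mfb_down; case: ifP => // _; exact: ltW.
- by rewrite /mfb_stay; case: ifP.
- exact: le_trans (V_ge i).
Qed.

End mfb_kernel.

(** * Occupation probabilities and expected arrivals *)

Section mfb_walk.
Variables (R : realType) (N : nat) (p0 q0 r0 s0 p q r : R) (i0 : int).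
Variables (d : measure_display) (T : measurableType d) (P : probability T R).
Variable X : nat -> T -> option int.
Hypothesis hX :
  markov_chain P (Some i0) (mfb_transition N p0 q0 r0 s0 p q r) X.

Let up := mfb_up N p0 p.
Let down := mfb_down N q0 q.
Let stay := mfb_stay N r0 r.

Let QE i j : mfb_transition N p0 q0 r0 s0 p q r (Some i) (Some j) =
  up i *+ (j == i + 1) + down i *+ (j == i - 1) + stay i *+ (j == i).
Proof. by rewrite /= /up /mfb_up /down /mfb_down /stay /mfb_stay; case: ifP. Qed.

(** Since [None] never leads back to an integer, absorption is mere loss of mass and the kernel on
    the integers describes the walk. *)
Lemma mfb_occupation m j :
  P [set w | X m w = Some j] = (tri_iter up down stay m i0 j)%:E.
Proof.
elim: m j => [|m ih] j; first by rewrite (markov_start hX).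
rewrite (@markov_forward _ _ _ _ _ _ _ _ hX m (Some j)
  [:: Some (j - 1); Some (j + 1); Some j]); first last.
- case=> [i|//]; rewrite !inE !negb_or => /and3P[h1 h2 h3]; rewrite QE.
  have -> : (j == i + 1) = false by apply: contraNF h1 => /eqP ->; rewrite addrK.
  have -> : (j == i - 1) = false by apply: contraNF h2 => /eqP ->; rewrite subrK.
  have -> : (j == i) = false by apply: contraNF h3 => /eqP ->.
  by rewrite !mulr0n !addr0.
- rewrite /= !inE; have neq (a b : int) : a <> b -> (Some a == Some b) = false.
    by move=> ab; apply/eqP => -[].
  by rewrite !neq//; lia.
rewrite !big_cons big_nil adde0 !ih !QE subrK addrK !eqxx.
have neq (a b : int) : a <> b -> (a == b) = false by move/eqP/negbTE.
rewrite (neq j (j - 1 - 1)) ?(neq j (j - 1)) ?(neq j (j + 1)) ?(neq j (j + 1 + 1));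
  try by lia.
by rewrite !mulr0n !mulr1n !addr0 !add0r -!EFinM -!EFinD addrA tri_iter_last.
Qed.

Hypotheses (hN : (1 < N)%N) (hp0 : 0 <= p0) (hq0 : 0 <= q0) (hr0 : 0 <= r0).
Hypotheses (hs0 : 0 < s0) (hsum0 : p0 + q0 + r0 + s0 = 1).
Hypotheses (hp : 0 < p) (hq : 0 < q) (hr : 0 <= r) (hrE : r = 1 - p - q).

(** The partial sums are bounded by the supersolution at [i0]. Finiteness makes [fine] faithful,
    since it would send an infinite value to 0. *)
Lemma expected_arrivals_fin_num j : expected_arrivals P X j \is a fin_num.
Proof.
have [C hC] := mfb_iter_sum_bounded hN hp0 hq0 hr0 hs0 hsum0 hp hq hr hrE i0.
rewrite ge0_fin_numE; last exact: nneseries_ge0.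
apply: (@le_lt_trans _ _ C%:E); last exact: ltry.
apply: lime_le; first exact: is_cvg_nneseries.
apply: nearW => M /=; under eq_bigr do rewrite mfb_occupation.
by rewrite sumEFin lee_fin.
Qed.

(** Time 0 gives the source term; the last-step recursion, summed over the later times, gives the
    rest. *)
Lemma expected_arrivals_balance j (x := fun j => fine (expected_arrivals P X j)) :
  x j = (j == i0)%:R + up (j - 1) * x (j - 1) + down (j + 1) * x (j + 1)
    + stay j * x j.
Proof.
have EFx k : (x k)%:E = expected_arrivals P X k.
  by rewrite fineK// expected_arrivals_fin_num.
apply: EFin_inj; rewrite !EFinD !EFinM !EFx.
rewrite [LHS]nneseries_recl// (markov_start hX) -!addeA; congr (_ + _)%E.
rewrite -(nneseries_addn 1%N)// /expected_arrivals -!nneseriesZl//.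
have up0 i : 0 <= up i by rewrite /up /mfb_up; case: ifP => // _; exact: ltW.
have down0 i : 0 <= down i.
  by rewrite /down /mfb_down; case: ifP => // _; exact: ltW.
have stay0 i : 0 <= stay i by rewrite /stay /mfb_stay; case: ifP.
rewrite -!nneseriesD//; try by move=> *; rewrite ?adde_ge0 ?mule_ge0 ?lee_fin.
apply: eq_eseriesr => m _; rewrite addn1 !mfb_occupation tri_iter_last.
by rewrite !EFinD !EFinM addeA.
Qed.

End mfb_walk.

(** * Geometric sums, without division by 1 - x *)

Definition geom_sum (R : realType) (x : R) (n : nat) : R :=
  \sum_(0 <= k < n) x ^+ k.

Lemma geom_sum0 (R : realType) (x : R) : geom_sum x 0 = 0.
Proof. by rewrite /geom_sum big_geq. Qed.

Lemma geom_sumS (R : realType) (x : R) n :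
  geom_sum x n.+1 = geom_sum x n + x ^+ n.
Proof. by rewrite /geom_sum big_nat_recr. Qed.

Lemma geom_sumSl (R : realType) (x : R) n :
  geom_sum x n.+1 = 1 + x * geom_sum x n.
Proof.
rewrite /geom_sum big_nat_recl// expr0 mulr_sumr; congr (_ + _).
by apply: eq_bigr => k _; rewrite exprS.
Qed.

Lemma geom_sum_closed (R : realType) (x : R) n :
  (1 - x) * geom_sum x n = 1 - x ^+ n.
Proof.
by elim: n => [|n ih]; rewrite ?geom_sum0 ?geom_sumS ?mulrDr ?ih ?exprS; ring.
Qed.

Lemma geom_sum_one (R : realType) n : geom_sum (1 : R) n = n%:R.
Proof.
by elim: n => [|n ih]; rewrite ?geom_sum0// geom_sumS ih expr1n natr1.
Qed.

(** * The recurrence between two barriers *)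

Section two_point_problem.
Variables (R : realType) (N : nat) (p q e : R) (i0 : nat) (y : nat -> R).
Hypothesis q_gt0 : 0 < q.
Hypothesis hy : forall n, (0 < n < N)%N ->
  (p + q) * y n = p * y n.-1 + q * y n.+1 + e * (n == i0)%:R.

Local Notation rho := (p / q).
Local Notation s := (geom_sum rho).

(** The first increment, corrected when i_0 = 0, where the source term of the explicit formula
    already acts from n = 0. *)
Let c : R := y 1%N - y 0%N + e / q * (i0 == 0%N)%:R.

(** The source lowers the increment after i_0 by e/q, and this change propagates with ratio [rho].
    Truncated subtraction makes its term vanish for n <= i_0. *)
Let y_explicit n : (n <= N)%N ->
  y n = y 0%N + s n * c - e / q * s (n - i0)%N.
Proof.
have s0 := geom_sum0 rho.
have q0 : q != 0 by rewrite gt_eqF.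
suff H m : (m.+1 <= N)%N ->
    y m = y 0%N + s m * c - e / q * s (m - i0)%N /\
    y m.+1 = y 0%N + s m.+1 * c - e / q * s (m.+1 - i0)%N.
  case: n => [|n] nN; last by case: (H n nN).
  by rewrite sub0n s0 mul0r mulr0 addr0 subr0.
elim: m => [_|m ih mN].
  rewrite sub0n geom_sumS s0 expr0 (_ : s (1 - i0)%N = (i0 == 0%N)%:R).
    by split; rewrite /c; ring.
  by case: (i0) => [|i]; rewrite ?subn0 ?subSS ?sub0n ?geom_sumS s0 ?expr0 ?add0r.
have [ym ym1] := ih (ltnW mN); split=> //.
have -> : y m.+2 = y m.+1 + rho * (y m.+1 - y m) - e / q * (m.+1 == i0)%:R.
  have h := hy (n := m.+1) mN; rewrite /= in h.
  have -> : y m.+2 = ((p + q) * y m.+1 - p * y m - e * (m.+1 == i0)%:R) / q.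
    by apply: (mulfI q0); rewrite mulrCA mulfV// mulr1 h; ring.
  by field.
rewrite ym ym1.
(* The truncated sum solves the homogeneous recurrence except for a unit jump at m + 1 = i_0, which
   matches the source. *)
have -> : s (m.+2 - i0) = s (m.+1 - i0) + rho * (s (m.+1 - i0) - s (m - i0))
    + (m.+1 == i0)%:R.
  case: (ltngtP m.+1 i0) => mi.
  - rewrite (eqP (_ : m.+2 - i0 == 0)%N) ?subn_eq0//.
    rewrite (eqP (_ : m.+1 - i0 == 0)%N) ?subn_eq0 ?(ltnW mi)//.
    by rewrite (eqP (_ : m - i0 == 0)%N) ?subn_eq0 ?s0 ?(ltnW (ltnW mi))//=; ring.
  - have im : (i0 <= m)%N := mi.
    by rewrite !subSn ?leqW// (geom_sumSl _ _.+1) (geom_sumSl _ (_ - _)) /=; ring.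
  - by rewrite -mi subnn subSS subSnn (eqP (_ : m - m.+1 == 0)%N) ?subn_eq0//
      s0 geom_sumS s0 expr0 /=; ring.
by rewrite (geom_sumSl _ m.+1) (geom_sumSl _ m); ring.
Qed.

(** The unknown [c] is eliminated between the explicit formulas at [n] and at [N]. *)
Lemma two_point_geometric n : (n <= N)%N ->
  s N * y n = (s N - s n) * y 0%N + s n * y N
    + e / q * (s n * s (N - i0)%N - s N * s (n - i0)%N).
Proof.
by move=> nN; rewrite (y_explicit nN) (y_explicit (leqnn N)); ring.
Qed.

End two_point_problem.

(** * Expected arrivals between the barriers *)

Theorem theorem8 (R : realType) (N : nat) (p0 q0 r0 s0 p q r : R) (i0 : nat)
    (d : measure_display) (T : measurableType d) (P : probability T R)
    (X : nat -> T -> option int)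
    (hN : (1 < N)%N)
    (hp0 : 0 <= p0) (hq0 : 0 <= q0) (hr0 : 0 <= r0) (hs0 : 0 <= s0)
    (hsum0 : p0 + q0 + r0 + s0 = 1) (hpos0 : 0 < p0 * q0 * s0)
    (hp : 0 <= p) (hq : 0 <= q) (hr : 0 <= r)
    (hrE : r = 1 - p - q) (hpos : 0 < p * q)
    (hi0 : (i0 < N)%N)
    (hX : markov_chain P (Some (i0%:Z)) (mfb_transition N p0 q0 r0 s0 p q r) X) :
  let rho : R := p / q in
  let x (j : int) : R := fine (expected_arrivals P X j) in
  (forall j : int, expected_arrivals P X j \is a fin_num) /\
  forall (k : int) (n : nat), (1 <= n <= N - 1)%N ->
    (rho != 1 ->
      ((1 <= n <= i0)%N ->
        (1 - rho ^+ N) * x (k * N%:Z + n%:Z) =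
          p0 / p * (rho ^+ n - rho ^+ N) * x (k * N%:Z)
          + q0 / q * (1 - rho ^+ n) * x ((k + 1) * N%:Z)
          + (1 - rho ^+ n) * (rho ^+ (N - i0) - 1) / (p - q) * (k == 0)%:R)
      /\
      ((i0 <= n <= N - 1)%N ->
        (1 - rho ^+ N) * x (k * N%:Z + n%:Z) =
          p0 / p * (rho ^+ n - rho ^+ N) * x (k * N%:Z)
          + q0 / q * (1 - rho ^+ n) * x ((k + 1) * N%:Z)
          + (rho ^+ n - rho ^+ N) * (1 - rho ^- i0) / (p - q) * (k == 0)%:R))
    /\
    (rho = 1 ->
      ((1 <= n <= i0)%N ->
        x (k * N%:Z + n%:Z) =
          (p0 * (N%:R - n%:R) * x (k * N%:Z) + q0 * n%:R * x ((k + 1) * N%:Z)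
           + n%:R * (N%:R - i0%:R) * (k == 0)%:R) / (p * N%:R))
      /\
      ((i0 <= n <= N - 1)%N ->
        x (k * N%:Z + n%:Z) =
          (p0 * (N%:R - n%:R) * x (k * N%:Z) + q0 * n%:R * x ((k + 1) * N%:Z)
           + i0%:R * (N%:R - n%:R) * (k == 0)%:R) / (p * N%:R))).
Proof.
move=> rho x.
have p_gt0 : 0 < p.
  by rewrite lt_neqAle hp andbT; apply: contraTneq hpos => <-; rewrite mul0r ltxx.
have q_gt0 : 0 < q.
  by rewrite lt_neqAle hq andbT; apply: contraTneq hpos => <-; rewrite mulr0 ltxx.
have s0_gt0 : 0 < s0.
  by rewrite lt_neqAle hs0 andbT; apply: contraTneq hpos0 => <-; rewrite mulr0 ltxx.
have fin := expected_arrivals_fin_num hX hN hp0 hq0 hr0 s0_gt0 hsum0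
  p_gt0 q_gt0 hr hrE.
have bal := expected_arrivals_balance hX hN hp0 hq0 hr0 s0_gt0 hsum0
  p_gt0 q_gt0 hr hrE.
rewrite -/x in bal.
split=> // k n /andP[n0 nN1].
have nN : (n < N)%N by rewrite (leq_ltn_trans nN1)// subn1 ltn_predL ltnW.
(* Rescaling the two barrier values makes the recurrence constant-coefficient. *)
pose y m := if m == 0%N then p0 / p * x (k * N%:Z) else
  if m == N then q0 / q * x ((k + 1) * N%:Z) else x (k * N%:Z + m%:Z).
have p_neq0 : p != 0 by rewrite gt_eqF.
have q_neq0 : q != 0 by rewrite gt_eqF.
have N_neq0 : N%:R != 0 :> R by rewrite pnatr_eq0 -lt0n ltnW.
have hy m : (0 < m < N)%N ->
    (p + q) * y m = p * y m.-1 + q * y m.+1 + (k == 0)%:R * (m == i0)%:R.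
  move=> m0N; have /andP[m0 mN] := m0N.
  have := bal (k * N%:Z + m%:Z).
  (* As [m] and [i0] are both below [N], uniqueness of Euclidean division puts the source in the
     block k = 0 only. *)
  have -> : (k * N%:Z + m%:Z == i0%:Z)%:R = (k == 0)%:R * (m == i0)%:R :> R.
    have [->|k0] := eqVneq k 0; first by rewrite mul0r add0r mul1r.
    rewrite mul0r; case: eqP => // /(divz_decomp_uniq mN hi0)/eqP.
    by rewrite (negbTE k0).
  rewrite /mfb_stay dvdz_between//.
  have -> : mfb_up N p0 p (k * N%:Z + m%:Z - 1) * x (k * N%:Z + m%:Z - 1)
      = p * y m.-1.
    rewrite -addrA -{1 2}(prednK m0) -addn1 PoszD addrK /mfb_up /y.
    case: m m0 mN {m0N} => // m _ mN /=; rewrite dvdz_MDl.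
    have [->|mn0] := posnP m; first by rewrite dvdn0 addr0; field.
    by rewrite gtnNdvd// ?(ltnW mN)// ltn_eqF// ltnW.
  have -> : mfb_down N q0 q (k * N%:Z + m%:Z + 1) * x (k * N%:Z + m%:Z + 1)
      = q * y m.+1.
    rewrite -addrA -PoszD addn1 /mfb_down /y /= dvdz_MDl.
    case: eqVneq => [->|mn]; first by rewrite dvdnn mulrDl mul1r; field.
    by rewrite gtnNdvd// ltn_neqAle mn.
  have -> : y m = x (k * N%:Z + m%:Z) by rewrite /y gtn_eqF// ltn_eqF.
  by rewrite hrE => h; lra.
have := two_point_geometric q_gt0 hy (ltnW nN); rewrite -/rho.
have -> : y 0%N = p0 / p * x (k * N%:Z) by [].
have -> : y N = q0 / q * x ((k + 1) * N%:Z).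
  by rewrite /y eqxx gtn_eqF// ltnW.
have -> : y n = x (k * N%:Z + n%:Z) by rewrite /y gtn_eqF// ltn_eqF.
set xk := x (k * _); set xk1 := x ((k + 1) * _); set xn := x (_ + _).
set e : R := (k == 0)%:R => H.
split=> [rho1|rho1].
  have r1 : 1 - rho != 0 by rewrite subr_eq0 eq_sym.
  have pq : p - q = - (q * (1 - rho)) by rewrite /rho; field.
  (* Multiplication by 1 - rho turns geometric sums into powers. The two ranges of [n] differ only
     in the truncated [n - i0]. *)
  have H' : (1 - rho ^+ N) * xn = p0 / p * (rho ^+ n - rho ^+ N) * xk
      + q0 / q * (1 - rho ^+ n) * xk1
      - ((1 - rho ^+ n) * (1 - rho ^+ (N - i0))
         - (1 - rho ^+ N) * (1 - rho ^+ (n - i0))) / (p - q) * e.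
    have E m : rho ^+ m = 1 - (1 - rho) * geom_sum rho m.
      by rewrite geom_sum_closed; ring.
    rewrite pq !E; transitivity ((1 - rho) * (geom_sum rho N * xn)); first by ring.
    by rewrite H; clearbody rho; field; rewrite r1 q_neq0.
  split=> /andP[h1 h2]; rewrite H'.
    by rewrite (eqP (_ : n - i0 == 0)%N) ?subn_eq0// expr0; ring.
  have rho_unit : rho \is a GRing.unit by rewrite unitfE mulf_neq0 ?invr_eq0.
  by rewrite !exprB ?(ltnW hi0)//; ring.
have qp : q = p by move: rho1; rewrite /rho => /divr1_eq.
rewrite rho1 !geom_sum_one qp in H.
split=> /andP[h1 h2]; apply: (mulfI N_neq0); rewrite H.
  rewrite (eqP (_ : n - i0 == 0)%N) ?subn_eq0// natrB ?(ltnW hi0)//.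
  by field; rewrite ?p_neq0 ?N_neq0.
(* The source coefficient is n(N - i_0) - N(n - i_0) = i_0(N - n). *)
rewrite (natrB _ (ltnW hi0)) (natrB _ h1).
by field; rewrite ?p_neq0 ?N_neq0.
Qed.
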